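(* Let $\|\cdot\|$ be a norm on $\mathbb{R}^n$, let $\Omega\subseteq\mathbb{R}^n$ be an open set and $F:\Omega\to\mathbb{R}^n$ a continuously differentiable function. Let $x_*\in\Omega$, $R>0$ and $$\kappa:=\sup\{t\in[0,R): B(x_*,t)\subset\Omega\}.$$ Suppose that $F(x_* )=0$, $F'(x_* )$ is invertible, and there exists a continuously differentiable $f:[0,R)\to\mathbb{R}$ such that $$\left\|F'(x_* )^{-1}\left[F'(x)-F'(x_*+\tau(x-x_* ))\right]\right\|\le f'(\|x-x_*\|)-f'(\tau\|x-x_*\|)$$ for all $\tau\in[0,1]$ and $x\in B(x_*,\kappa)$, where $f(0)=0$, $f'(0)=-1$, and $f'$ is convex and strictly increasing. Take $0\le\vartheta<1$ and $0\le\omega_2<\omega_1$ such that $\omega_1\vartheta+\omega_2<1$. Let $\nu:=\sup\{t\in[0,R): f'(t)<0\}$, $$\rho:=\sup\left\{t\in(0,\nu): \omega_1(1+\vartheta)\left[\frac{f(t)}{tf'(t)}-1\right]+\omega_1\vartheta+\omega_2<1\right\},\qquad \sigma:=\min\{\kappa,\rho\}.$$ Then any inexact Newton-like method for solving $F(x)=0$ with initial point $x_0\in B(x_*,\sigma)\setminus\{x_*\}$, $$x_{k+1}=x_k+S_k,\qquad B(x_k)S_k=-F(x_k)+r_k,\qquad k=0,1,\ldots,$$ where $B(x_k)$ is an invertible approximation of $F'(x_k)$ satisfying $$\|B(x_k)^{-1}F'(x_k)\|\le\omega_1,\qquad \|B(x_k)^{-1}F'(x_k)-I\|\le\omega_2,$$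 and the residual $r_k$ satisfies $$\|P_kr_k\|\le\theta_k\|P_kF(x_k)\|$$ for some sequence $\{P_k\}$ of invertible matrices (preconditioners) and some sequence $\{\theta_k\}$ of non-negative numbers satisfying $$\theta_k\,\mathrm{cond}(P_kF'(x_k))\le\vartheta,$$ is well defined, its sequence $\{x_k\}$ is contained in $B(x_*,\sigma)$, converges to $x_*$, and $$\|x_{k+1}-x_*\|\le\left[\omega_1(1+\vartheta)\left(\frac{f(\|x_0-x_*\|)}{\|x_0-x_*\|\,f'(\|x_0-x_*\|)}-1\right)+\omega_1\vartheta+\omega_2\right]\|x_k-x_*\|,\qquad k=0,1,\ldots.$$
   Context: $B(a,\delta)=\{x\in\mathbb{R}^n:\|x-a\|<\delta\}$. Norms of linear operators on $\mathbb{R}^n$ are the operator norms induced by the given norm $\|\cdot\|$; $I$ is the identity; for an invertible operator $T$, $\mathrm{cond}(T):=\|T\|\,\|T^{-1}\|$. ''Well defined'' means that each iterate $x_k$ lies in $\Omega$ and $F'(x_k)$ is invertible, so that the conditions defining the next step make sense. *)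

(* Defs.v *)
From HB Require Import structures.
From mathcomp Require Import all_boot all_order all_algebra.
From mathcomp Require Import all_classical all_reals all_analysis.

Set Implicit Arguments.
Unset Strict Implicit.
Unset Printing Implicit Defensive.

Import Order.TTheory GRing.Theory Num.Theory.
Import numFieldNormedType.Exports.

Local Open Scope classical_set_scope.
Local Open Scope ring_scope.

(* R^n is 'cV[R]_n with its canonical topology, which is the one induced by
   any norm.  `|x| is the library's sup norm on 'cV[R]_n, so an arbitrary norm
   is carried as a function N.  Operators act by v |-> A *m v. *)

Record is_norm (R : realType) (n : nat) (N : 'cV[R]_n -> R) : Prop := IsNorm {
  norm_triangle : forall u v, N (u + v) <= N u + N v;
  norm_homogeneous : forall (a : R) v, N (a *: v) = `|a| * N v;
  norm_definite : forall v, N v = 0 -> v = 0 }.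

Definition nball (R : realType) (n : nat) (N : 'cV[R]_n -> R)
    (a : 'cV[R]_n) (delta : R) : set 'cV[R]_n :=
  [set x | N (x - a) < delta].

Definition opnorm (R : realType) (n : nat) (N : 'cV[R]_n -> R)
    (A : 'M[R]_n) : R :=
  sup [set N (A *m v) | v in [set v | N v <= 1]].

(* Meaningful for invertible A only: invmx A is A when A is singular. *)
Definition condn (R : realType) (n : nat) (N : 'cV[R]_n -> R)
    (A : 'M[R]_n) : R :=
  opnorm N A * opnorm N (invmx A).

(* The library's jacobian is for row vectors, acting on the right. *)
Definition jac (R : realType) (n : nat) (F : 'cV[R]_n -> 'cV[R]_n)
    (x : 'cV[R]_n) : 'M[R]_n :=
  \matrix_(i < n, j < n) ('d F x (delta_mx j 0)) i 0.

(* Omega is meant to be open, so that the values of F outside Omega are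
   irrelevant. *)
Definition C1_on (R : realType) (n : nat) (Omega : set 'cV[R]_n)
    (F : 'cV[R]_n -> 'cV[R]_n) : Prop :=
  (forall x, Omega x -> differentiable F x) /\
  (forall x, Omega x -> {for x, continuous (jac F)}).

(* f is continuously differentiable on A with derivative f'; difference
   quotients are taken inside A, hence one-sided at an endpoint of A. *)
Definition C1_within (R : realType) (A : set R) (f f' : R -> R) : Prop :=
  (forall t, A t ->
     (f s - f t) / (s - t) @[s --> within A t^'] --> f' t) /\
  {within A, continuous f'}.

Definition kappa (R : realType) (n : nat) (N : 'cV[R]_n -> R)
    (Omega : set 'cV[R]_n) (xs : 'cV[R]_n) (rad : R) : R :=
  sup [set t | 0 <= t < rad /\ nball N xs t `<=` Omega].

Definition nu (R : realType) (f' : R -> R) (rad : R) : R :=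
  sup [set t | 0 <= t < rad /\ f' t < 0].

Definition rate (R : realType) (f f' : R -> R) (vtheta om1 om2 t : R) : R :=
  om1 * (1 + vtheta) * (f t / (t * f' t) - 1) + om1 * vtheta + om2.

Definition rho (R : realType) (f f' : R -> R) (rad vtheta om1 om2 : R) : R :=
  sup [set t | 0 < t < nu f' rad /\ rate f f' vtheta om1 om2 t < 1].

Definition sigma (R : realType) (n : nat) (N : 'cV[R]_n -> R)
    (Omega : set 'cV[R]_n) (xs : 'cV[R]_n) (f f' : R -> R)
    (rad vtheta om1 om2 : R) : R :=
  Num.min (kappa N Omega xs rad) (rho f f' rad vtheta om1 om2).

(* One step x |-> x1 of the method, with step S, residual r, preconditioner P
   and forcing term theta; B is the approximation of the derivative. *)
Record inexact_newton_like_step (R : realType) (n : nat)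
    (N : 'cV[R]_n -> R) (F : 'cV[R]_n -> 'cV[R]_n)
    (B : 'cV[R]_n -> 'M[R]_n) (vtheta om1 om2 : R)
    (P : 'M[R]_n) (theta : R) (S r x x1 : 'cV[R]_n) : Prop :=
  InexactNewtonLikeStep {
    step_next : x1 = x + S;
    step_eq : B x *m S = - F x + r;
    step_B_unit : B x \in unitmx;
    step_om1 : opnorm N (invmx (B x) *m jac F x) <= om1;
    step_om2 : opnorm N (invmx (B x) *m jac F x - 1%:M) <= om2;
    step_P_unit : P \in unitmx;
    step_theta_ge0 : 0 <= theta;
    step_residual : N (P *m r) <= theta * N (P *m F x);
    step_cond : theta * condn N (P *m jac F x) <= vtheta }.

(* Main.v *)
Require Import Defs.
From HB Require Import structures.
From mathcomp Require Import all_boot all_order all_algebra.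
From mathcomp Require Import all_classical all_reals all_analysis.
From mathcomp Require Import ring lra.

Set Implicit Arguments.
Unset Strict Implicit.
Unset Printing Implicit Defensive.

Import Order.TTheory GRing.Theory Num.Theory.
Import numFieldNormedType.Exports.

Local Open Scope classical_set_scope.
Local Open Scope ring_scope.

(** The mean value inequality applied to
    s |-> F'(xs)^-1 (s F'(x) (x - xs) - F (xs + s (x - xs))) against the scalar
    function s |-> s t f'(t) - f(s t), t = N (x - xs), bounds the linearization
    error at x by t f'(t) - f(t).  The case tau = 0 of the majorant condition
    gives N (F'(x)^-1 F'(xs) v) <= N v / - f'(t), so F'(x) is invertible and
    F'(x)^-1 times the linearization error is at most f(t) / f'(t) - t.
    Splitting
    x1 - xs = (I - B^-1 F') (x - xs) + B^-1 F' (F'^-1 (F' (x - xs) - F x))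
              + B^-1 F' (P F')^-1 P r
    then bounds N (x1 - xs) by rate t * t.  Finally f(t) / (t f'(t)) is
    nondecreasing in t because f' is convex, so the rate at x0 is below 1 and
    bounds the rate at all later iterates. *)

(** * Arbitrary norms on R^n and their equivalence with the sup norm *)

Lemma is_norm0 (R : realType) (n : nat) (N : 'cV[R]_n -> R) :
  is_norm N -> N 0 = 0.
Proof. by move=> hN; rewrite -(scale0r 0) norm_homogeneous// normr0 mul0r. Qed.

Lemma is_normN (R : realType) (n : nat) (N : 'cV[R]_n -> R) v :
  is_norm N -> N (- v) = N v.
Proof.
by move=> hN; rewrite -scaleN1r norm_homogeneous// normrN normr1 mul1r.
Qed.

Lemma is_norm_ge0 (R : realType) (n : nat) (N : 'cV[R]_n -> R) v :
  is_norm N -> 0 <= N v.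
Proof.
move=> hN; have := norm_triangle hN v (- v).
by rewrite subrr is_norm0// is_normN//; lra.
Qed.

Lemma is_norm_gt0 (R : realType) (n : nat) (N : 'cV[R]_n -> R) v :
  is_norm N -> v != 0 -> 0 < N v.
Proof.
move=> hN v0; rewrite lt_def is_norm_ge0// andbT.
by apply: contra v0 => /eqP/(norm_definite hN) ->.
Qed.

Lemma is_norm_distC (R : realType) (n : nat) (N : 'cV[R]_n -> R) u v :
  is_norm N -> N (u - v) = N (v - u).
Proof. by move=> hN; rewrite -opprB is_normN. Qed.

Lemma is_norm_sum (R : realType) (n : nat) (N : 'cV[R]_n -> R) (I : Type)
    (s : seq I) (G : I -> 'cV[R]_n) :
  is_norm N -> N (\sum_(i <- s) G i) <= \sum_(i <- s) N (G i).
Proof.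
move=> hN; elim/big_ind2 : _ => //; first by rewrite is_norm0.
by move=> a b c d ab cd; apply: le_trans (norm_triangle hN _ _) (lerD ab cd).
Qed.

Lemma ler_coord_mx_norm (R : realType) (m n : nat) (v : 'M[R]_(m, n)) i j :
  `|v i j| <= `|v|.
Proof.
rewrite [leRHS]/Num.norm /= mx_normrE.
by apply/bigmax_geP; right => /=; exists (i, j).
Qed.

Lemma mx_norm_tr (R : realType) (m n : nat) (v : 'M[R]_(m, n)) :
  `|v^T| = `|v|.
Proof.
suff le_tr a b (w : 'M[R]_(a, b)) : `|w^T| <= `|w|.
  by apply/eqP; rewrite eq_le le_tr -{1}[v]trmxK le_tr.
rewrite [leLHS]/Num.norm /= mx_normrE; apply/bigmax_leP; split => //= -[i j] _.
by rewrite mxE ler_coord_mx_norm.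
Qed.

(** Expand [v] in the standard basis: the sum of the norms of the basis vectors bounds [N v]
    relative to the largest coordinate. *)
Lemma is_norm_le_mx_norm (R : realType) (n : nat) (N : 'cV[R]_n -> R) :
  is_norm N -> exists2 C, 0 < C & forall v, N v <= C * `|v|.
Proof.
move=> hN; pose C := \sum_(i < n) N (delta_mx i 0).
have C0 : 0 <= C by apply: sumr_ge0 => i _; exact: is_norm_ge0.
(* Adding 1 keeps the constant positive when [n = 0] and the sum is empty. *)
exists (C + 1) => [|v]; first lra.
apply: (@le_trans _ _ (C * `|v|)); last by rewrite ler_wpM2r// lerDl.
rewrite [in leLHS](matrix_sum_delta v).
apply: le_trans (is_norm_sum _ _ hN) _.
rewrite mulr_suml ler_sum// => i _.
rewrite big_ord1 norm_homogeneous// mulrC ler_wpM2l ?is_norm_ge0//.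
exact: ler_coord_mx_norm.
Qed.

(** By the reverse triangle inequality [N] is Lipschitz for the sup norm. *)
Lemma is_norm_continuous (R : realType) (n : nat) (N : 'cV[R]_n -> R) :
  is_norm N -> continuous N.
Proof.
move=> hN u; have [C C0 NC] := is_norm_le_mx_norm hN.
apply/(@cvgrPdist_lt _ _ _ _ (nbhs_filter u)) => e e0.
have : \forall v \near u, `|u - v| < e / C.
  apply/nbhs_ballP; exists (e / C) => [|v]; last by rewrite -ball_normE.
  by rewrite /= divr_gt0.
apply: filterS => v; rewrite ltr_pdivlMr// mulrC => uv.
apply: le_lt_trans uv; apply: le_trans (NC _).
have := norm_triangle hN (u - v) v; have := norm_triangle hN (v - u) u.
by rewrite !subrK (is_norm_distC v)// ler_distl; lra.
Qed.

(** By compactness [N] attains a positive minimum on the unit sphere of the sup norm; its reciprocal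
    is the constant. The sphere is taken in row vectors, the setting of [EVT_min_rV] and
    [bounded_closed_compact]. *)
Lemma mx_norm_le_is_norm (R : realType) (n : nat) (N : 'cV[R]_n -> R) :
  is_norm N -> exists2 C, 0 < C & forall v, `|v| <= C * N v.
Proof.
move=> hN.
(* Without a nonzero vector the sphere is empty and has no minimum. *)
have [[v v0]|/forallNP all0] := pselect (exists v : 'cV[R]_n, v != 0); last first.
  exists 1 => // v; have /negP := all0 v; rewrite negbK => /eqP ->.
  by rewrite normr0 is_norm0// mulr0.
pose A := [set w : 'rV[R]_n | `|w| = 1].
have A0 : A !=set0.
  exists (`|v|^-1 *: v^T); rewrite /A /= normrZ mx_norm_tr normfV normr_id mulVf//.
  by rewrite normr_eq0.
have Acl : closed A.
  rewrite (_ : A = Num.norm @^-1` [set 1]); last by [].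
  by apply: closed_comp => [w _|]; [exact: norm_continuous|exact: closed_eq].
have Acp : compact A.
  apply: bounded_closed_compact Acl.
  by exists 1; split => // M M1 w /= ->; exact: ltW.
pose g (w : 'rV[R]_n) := N w^T.
have gc : continuous g.
  move=> w; apply: (@continuous_comp _ _ _ trmx N); last exact: is_norm_continuous.
  apply/(@cvgrPdist_lt _ _ _ _ (nbhs_filter w)) => e e0.
  have : \forall w' \near w, `|w - w'| < e.
    by apply/nbhs_ballP; exists e => // w'; rewrite -ball_normE.
  by apply: filterS => w'; rewrite -linearB /= mx_norm_tr.
have [w] := EVT_min_rV A0 Acp (continuous_subspaceT gc).
rewrite inE /A /= => w1 wmin.
have gw0 : 0 < g w.
  apply: is_norm_gt0 => //; apply/eqP => wT0.
  by move: w1; rewrite -mx_norm_tr wT0 normr0 => /eqP; rewrite eq_sym oner_eq0.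
exists (g w)^-1 => [|u]; first by rewrite invr_gt0.
have [->|u0] := eqVneq u 0; first by rewrite normr0 is_norm0// mulr0.
have nu0 : 0 < `|u| by rewrite normr_gt0.
rewrite mulrC ler_pdivlMr// mulrC -ler_pdivlMr// mulrC.
have := wmin (`|u|^-1 *: u^T); rewrite inE /A /= normrZ mx_norm_tr normfV normr_id.
rewrite mulVf ?gt_eqF// => /(_ erefl) /le_trans; apply.
by rewrite /g linearZ /= trmxK norm_homogeneous// normfV normr_id.
Qed.

(** * Operator norm *)

(** Makes the supremum in [opnorm] a genuine one. [A *m v] combines the columns of [A] with
    coefficients [v i 0], each at most [D] in absolute value on the unit ball of [N]. *)
Lemma opnorm_has_ubound (R : realType) (n : nat) (N : 'cV[R]_n -> R)
    (A : 'M[R]_n) :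
  is_norm N -> has_ubound [set N (A *m v) | v in [set v | N v <= 1]].
Proof.
move=> hN; have [C C0 NC] := is_norm_le_mx_norm hN.
have [D D0 ND] := mx_norm_le_is_norm hN.
exists (\sum_(i < n) D * N (col i A)) => _ [v /= v1 <-].
have -> : A *m v = \sum_i v i 0 *: col i A.
  apply/colP => i; rewrite !mxE summxE; apply: eq_bigr => j _.
  by rewrite !mxE mulrC.
apply: le_trans (is_norm_sum _ _ hN) _; apply: ler_sum => i _.
rewrite norm_homogeneous// ler_wpM2r ?is_norm_ge0//.
apply: le_trans (ler_coord_mx_norm _ _ _) _; apply: le_trans (ND v) _.
by rewrite ler_piMr// ltW.
Qed.

Lemma opnorm_bound (R : realType) (n : nat) (N : 'cV[R]_n -> R)
    (A : 'M[R]_n) v :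
  is_norm N -> N (A *m v) <= opnorm N A * N v.
Proof.
move=> hN; have [->|v0] := eqVneq v 0.
  by rewrite mulmx0 is_norm0// mulr0.
have Nv0 := is_norm_gt0 hN v0.
rewrite -ler_pdivrMr// mulrC; apply: (ub_le_sup (opnorm_has_ubound A hN)).
exists ((N v)^-1 *: v) => /=.
  by rewrite norm_homogeneous// ger0_norm ?invr_ge0 ?(ltW Nv0)// mulVf ?gt_eqF.
by rewrite -scalemxAr norm_homogeneous// ger0_norm// invr_ge0 ltW.
Qed.

Lemma opnorm_ge0 (R : realType) (n : nat) (N : 'cV[R]_n -> R) (A : 'M[R]_n) :
  is_norm N -> 0 <= opnorm N A.
Proof.
move=> hN; apply: (ub_le_sup (opnorm_has_ubound A hN)); exists 0 => /=.
  by rewrite is_norm0.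
by rewrite mulmx0 is_norm0.
Qed.

Lemma le_opnorm_bound (R : realType) (n : nat) (N : 'cV[R]_n -> R)
    (A : 'M[R]_n) v c :
  is_norm N -> opnorm N A <= c -> N (A *m v) <= c * N v.
Proof.
move=> hN Ac; apply: le_trans (opnorm_bound _ _ hN) _.
by rewrite ler_wpM2r ?is_norm_ge0.
Qed.

(** * Mean value inequalities *)

(* The straddling points p <= c <= q make continuity of u superfluous. *)
Lemma le_of_straddle (R : realType) (u : R -> R) :
  (forall c : R, 0 <= c <= 1 -> forall e : R, 0 < e -> exists2 d, 0 < d &
     forall p q : R, 0 <= p -> p <= c -> c <= q -> q <= 1 -> q - p < d ->
       u q - u p <= e * (q - p)) ->
  u 1 <= u 0.
Proof.
move=> hu; apply/ler_addgt0Pr => e e0.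
(* Continuity induction: the bound with slope [e] is pushed from 0 up to 1 through the supremum of
   the points where it holds. *)
pose S := [set t | 0 <= t <= 1 /\ u t - u 0 <= e * t].
have S0 : S 0 by rewrite /S /= lexx ler01 subrr mulr0.
have Sub : ubound S 1 by move=> t [/andP[]].
have supS : has_sup S by split; [exists 0|exists 1].
have c0 : 0 <= sup S by apply: ub_le_sup S0; exists 1.
have c1 : sup S <= 1 by apply: ge_sup => //; exists 0.
have [|d d0 hd] := hu (sup S) _ e e0; first by rewrite c0 c1.
have [|s [/andP[s0 s1] us] cs] := @sup_adherent _ S (d / 2) _ supS.
  by rewrite divr_gt0.
have sc : s <= sup S by apply: ub_le_sup; [exists 1|split => //; rewrite s0].
have step q : sup S <= q -> q <= 1 -> q - s < d -> S q.
  move=> cq q1 qs; split; first by rewrite q1 (le_trans c0 cq).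
  by have := hd s q s0 sc cq q1 qs; lra.
(* As [s] lies within [d / 2] of [sup S], the smaller of 1 and [sup S + d / 4] is within reach of
   [step]; the latter would exceed the supremum. *)
have [cd|cd] := leP 1 (sup S + d / 4).
  suff [_] : S 1 by lra.
  by apply: step => //; lra.
have : S (sup S + d / 4) by apply: step; lra.
by move=> /(ub_le_sup (ex_intro _ 1 Sub)); lra.
Qed.

(** For [p <= c <= q] the expansions at [c] combine to [u q - u p <= (d c + e) * (q - p)].
    Expansions are required only inside [0, 1], so derivatives at the endpoints are one-sided. *)
Lemma derivative_le0_le (R : realType) (u d : R -> R) :
  (forall c : R, 0 <= c <= 1 -> forall e : R, 0 < e ->
     \forall s \near c, 0 <= s <= 1 ->
       `|u s - u c - d c * (s - c)| <= e * `|s - c|) ->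
  (forall c : R, 0 <= c <= 1 -> d c <= 0) ->
  u 1 <= u 0.
Proof.
move=> hu hd; apply: le_of_straddle => c c01 e e0.
have /nbhs_ballP[r /= r0 hr] := hu c c01 e e0.
exists r => // p q p0 pc cq q1 qp.
have /hr /= hp : ball c r p by rewrite /ball /= ger0_norm; lra.
have /hr /= hq : ball c r q by rewrite /ball /= ler0_norm; lra.
have {hp} : `|u p - u c - d c * (p - c)| <= e * `|p - c| by apply: hp; lra.
have {hq} : `|u q - u c - d c * (q - c)| <= e * `|q - c| by apply: hq; lra.
rewrite (@ger0_norm _ (q - c)) ?(@ler0_norm _ (p - c)); [|lra..].
have := hd c c01; rewrite !ler_norml => dc /andP[? ?] /andP[? ?].
have : d c * (q - p) <= 0 by rewrite mulr_le0_ge0//; lra.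
lra.
Qed.

(** The function [N (G s - G 0) - psi s] need not be differentiable, but it satisfies the straddling
    estimate. *)
Lemma mean_value_inequality (R : realType) (n : nat) (N : 'cV[R]_n -> R)
    (G dG : R -> 'cV[R]_n) (psi dpsi : R -> R) :
  is_norm N ->
  (forall c : R, 0 <= c <= 1 -> forall e : R, 0 < e ->
     \forall s \near c, 0 <= s <= 1 ->
       N (G s - G c - (s - c) *: dG c) <= e * `|s - c|) ->
  (forall c : R, 0 <= c <= 1 -> forall e : R, 0 < e ->
     \forall s \near c, 0 <= s <= 1 ->
       `|psi s - psi c - dpsi c * (s - c)| <= e * `|s - c|) ->
  (forall c : R, 0 <= c <= 1 -> N (dG c) <= dpsi c) ->
  N (G 1 - G 0) <= psi 1 - psi 0.
Proof.
move=> hN hG hpsi hle.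
suff : N (G 1 - G 0) - psi 1 <= N (G 0 - G 0) - psi 0.
  by rewrite subrr is_norm0//; lra.
apply: (@le_of_straddle _ (fun s => N (G s - G 0) - psi s)) => c c01 e e0.
(* One half of [e] is spent on [G], the other on [psi]. *)
have e20 : 0 < e / 2 by rewrite divr_gt0.
have /nbhs_ballP[r1 /= r10 hr1] := hG c c01 _ e20.
have /nbhs_ballP[r2 /= r20 hr2] := hpsi c c01 _ e20.
exists (Num.min r1 r2); first by rewrite lt_min r10 r20.
move=> p q p0 pc cq q1; rewrite lt_min => /andP[qp1 qp2].
have /hr1 /= Gp : ball c r1 p by rewrite /ball /= ger0_norm; lra.
have /hr1 /= Gq : ball c r1 q by rewrite /ball /= ler0_norm; lra.
have /hr2 /= pp : ball c r2 p by rewrite /ball /= ger0_norm; lra.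
have /hr2 /= pq : ball c r2 q by rewrite /ball /= ler0_norm; lra.
have {}Gp : N (G p - G c - (p - c) *: dG c) <= e / 2 * `|p - c| by apply: Gp; lra.
have {}Gq : N (G q - G c - (q - c) *: dG c) <= e / 2 * `|q - c| by apply: Gq; lra.
have {}pp : `|psi p - psi c - dpsi c * (p - c)| <= e / 2 * `|p - c|.
  by apply: pp; lra.
have {}pq : `|psi q - psi c - dpsi c * (q - c)| <= e / 2 * `|q - c|.
  by apply: pq; lra.
move: Gp Gq pp pq.
rewrite (@ger0_norm _ (q - c)) ?(@ler0_norm _ (p - c)); [|lra..].
rewrite !ler_norml => Gp Gq /andP[? ?] /andP[? ?].
have tri : N (G q - G 0) <= N (G p - G 0) + (N (G q - G c - (q - c) *: dG c)
    + (N (G p - G c - (p - c) *: dG c) + (q - p) * N (dG c))).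
  have -> : G q - G 0 = (G p - G 0) + ((G q - G c - (q - c) *: dG c)
      + (- (G p - G c - (p - c) *: dG c) + (q - p) *: dG c)).
    have -> : (q - p) *: dG c = (q - c) *: dG c - (p - c) *: dG c.
      by rewrite -scalerBl; congr (_ *: _); lra.
    by apply/colP => i; rewrite !mxE; ring.
  apply: le_trans (norm_triangle hN _ _) _; rewrite lerD2l.
  apply: le_trans (norm_triangle hN _ _) _; rewrite lerD2l.
  apply: le_trans (norm_triangle hN _ _) _.
  by rewrite is_normN// norm_homogeneous// ger0_norm//; lra.
have : (q - p) * N (dG c) <= (q - p) * dpsi c.
  by rewrite ler_wpM2l ?hle//; lra.
lra.
Qed.

(** * First-order expansions of [F] and of the majorant function *)

Lemma mul_jac (R : realType) (n : nat) (F : 'cV[R]_n -> 'cV[R]_n) x v :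
  jac F x *m v = 'd F x v.
Proof.
apply/colP => i; rewrite [in RHS](matrix_sum_delta v) linear_sum summxE mxE.
by apply: eq_bigr => j _; rewrite big_ord1 linearZ /= !mxE mulrC.
Qed.

Lemma jac_near (R : realType) (n : nat) (N : 'cV[R]_n -> R)
    (F : 'cV[R]_n -> 'cV[R]_n) x (e : R) :
  is_norm N -> differentiable F x -> 0 < e ->
  \forall y \near x, N (F y - F x - jac F x *m (y - x)) <= e * N (y - x).
Proof.
move=> hN dF e0.
have [C C0 NC] := is_norm_le_mx_norm hN.
have [D D0 ND] := mx_norm_le_is_norm hN.
(* The factors [C] and [D] absorb the passage from [N] to the sup norm and back. *)
have e'0 : 0 < e / (C * D) by rewrite divr_gt0// mulr_gt0.
have /eqaddoP/(_ _ e'0)/nbhs_ballP[r /= r0 hr] := diff_locally dF.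
apply/nbhs_ballP; exists r => //= y; rewrite -ball_normE /= distrC => xy.
have := hr (y - x); rewrite -ball_normE /= sub0r normrN => /(_ xy).
rewrite !fctE /= subrK mul_jac opprD addrA => Fy.
apply: le_trans (NC _) _; apply: le_trans (ler_wpM2l (ltW C0) Fy) _.
have -> : C * (e / (C * D) * `|y - x|) = e * (D^-1 * `|y - x|).
  by field; rewrite !gt_eqF.
by rewrite ler_pM2l// mulrC ler_pdivrMr// mulrC.
Qed.

(** Chain rule for [s |-> f (s * t)] on [0, 1], in the form the mean value lemmas take. For [t = 0]
    the function is constant; otherwise the tolerance and the radius are both divided by [t]. *)
Lemma C1_within_scale_near (R : realType) (f f' : R -> R) (rad t : R) :
  C1_within `[0, rad[ f f' -> 0 <= t < rad ->
  forall c : R, 0 <= c <= 1 -> forall e : R, 0 < e ->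
    \forall s \near c, 0 <= s <= 1 ->
      `|f (s * t) - f (c * t) - t * f' (c * t) * (s - c)| <= e * `|s - c|.
Proof.
move=> [hf _] /andP[t0 tr] c /andP[c0 c1] e e0.
have {t0}[t0|t0] : t = 0 \/ 0 < t by lra.
  apply/nbhs_ballP; exists 1 => //= s _ _.
  by rewrite t0 !mulr0 !mul0r !subrr normr0 mulr_ge0// ltW.
have Act : `[0, rad[%classic (c * t).
  rewrite /= in_itv /=; apply/andP; split; first by rewrite mulr_ge0// ltW.
  by apply: le_lt_trans tr; rewrite ler_piMl// ltW.
have et0 : 0 < e / t by rewrite divr_gt0.
have /cvgrPdist_lt/(_ _ et0)/nbhs_ballP[r /= r0 hr] := hf _ Act.
apply/nbhs_ballP; exists (r / t); first by rewrite /= divr_gt0.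
move=> s; rewrite /ball /= ltr_pdivlMr// => cs /andP[s0 s1].
have [->|sc] := eqVneq s c; first by rewrite !subrr mulr0 subrr normr0 mulr0.
have stne : s * t != c * t by rewrite (inj_eq (mulIf _))// gt_eqF.
have := hr (s * t); rewrite /ball /= -mulrBl normrM (gtr0_norm t0) => /(_ cs stne).
have Ast : s * t \in `[0, rad[.
  rewrite /= in_itv /=; apply/andP; split; first by rewrite mulr_ge0// ltW.
  by apply: le_lt_trans tr; rewrite ler_piMl// ltW.
move=> /(_ Ast); rewrite ltr_pdivlMr// => /ltW h.
have -> : f (s * t) - f (c * t) - t * f' (c * t) * (s - c) =
    - (f' (c * t) - (f (s * t) - f (c * t)) / (s * t - c * t)) * t * (s - c).
  by field; rewrite subr_eq0.
rewrite normrM ler_wpM2r// normrM normrN (gtr0_norm t0).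
by rewrite -mulrBl in h *.
Qed.

(** * Convexity, the majorant function and monotonicity of the rate *)

Lemma convex_function_le (R : realType) (g : R -> R) (rad x y l : R) :
  convex_function (`[0, rad[%classic : set R) g ->
  0 <= x < rad -> 0 <= y < rad -> 0 <= l <= 1 ->
  g (l * x + (1 - l) * y) <= l * g x + (1 - l) * g y.
Proof.
move=> hg hx hy /andP[l0 l1].
have := hg (Itv01 l0 l1) x y; rewrite !convRE /=; apply.
  by rewrite inE /= in_itv.
by rewrite inE /= in_itv.
Qed.

(** Both [c * t] and [s] lie between [c * s] and [t], with weights [l] and [m] on [t]. Adding the
    two convexity inequalities gives the claim because [l + m <= 1] and [g (c * s) < g t]. *)
Lemma convex_increment_le (R : realType) (g : R -> R) (rad s t c : R) :
  convex_function (`[0, rad[%classic : set R) g ->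
  {in `[0, rad[ &, {homo g : a b / a < b}} ->
  0 <= s -> s <= t -> t < rad -> 0 <= c <= 1 ->
  g (c * t) - g (c * s) <= g t - g s.
Proof.
move=> hg hinc s0 st tr /andP[c0 c1].
have {st}[->|st] : s = t \/ s < t by lra.
  by rewrite !subrr.
have cs0 : 0 <= c * s by rewrite mulr_ge0.
have css : c * s <= s by rewrite ler_piMl.
have D0 : 0 < t - c * s by lra.
pose l := c * (t - s) / (t - c * s); pose m := s * (1 - c) / (t - c * s).
have l0 : 0 <= l by rewrite divr_ge0 ?mulr_ge0//; lra.
have m0 : 0 <= m by rewrite divr_ge0 ?mulr_ge0//; lra.
have lm1 : l + m <= 1.
  rewrite /l /m -mulrDl ler_pdivrMr// mul1r.
  have : 0 <= (1 - c) * (t - s) by rewrite mulr_ge0//; lra.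
  lra.
have hct : c * t = l * t + (1 - l) * (c * s) by rewrite /l; field; rewrite gt_eqF.
have hs : s = m * t + (1 - m) * (c * s) by rewrite /m; field; rewrite gt_eqF.
have tin : 0 <= t < rad by lra.
have csin : 0 <= c * s < rad by lra.
have h1 : g (c * t) <= l * g t + (1 - l) * g (c * s).
  by rewrite hct; apply: convex_function_le hg _ _ _ => //; lra.
have h2 : g s <= m * g t + (1 - m) * g (c * s).
  by rewrite {1}hs; apply: convex_function_le hg _ _ _ => //; lra.
have h3 : g (c * s) < g t by apply: hinc; rewrite ?in_itv//=; lra.
have : 0 <= (1 - l - m) * (g t - g (c * s)) by rewrite mulr_ge0//; lra.
lra.
Qed.

Lemma incr_within_le (R : realType) (g : R -> R) (rad s t : R) :
  {in `[0, rad[ &, {homo g : a b / a < b}} ->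
  0 <= s -> s <= t -> t < rad -> g s <= g t.
Proof.
move=> hinc s0 st tr; have {st}[->//|st] : s = t \/ s < t by lra.
by apply/ltW/hinc => //; rewrite in_itv /=; lra.
Qed.

(** The function [f (s * t) - s * t * f' t] of [s] vanishes at 0 and has derivative
    [t * (f' (s * t) - f' t) <= 0]. *)
Lemma majorant_le_tangent (R : realType) (f f' : R -> R) (rad t : R) :
  C1_within `[0, rad[ f f' -> f 0 = 0 ->
  {in `[0, rad[ &, {homo f' : a b / a < b}} ->
  0 <= t < rad -> f t <= t * f' t.
Proof.
move=> hf f0 hinc ht.
have := @derivative_le0_le _ (fun s => f (s * t) - s * t * f' t)
  (fun c => t * f' (c * t) - t * f' t).
rewrite /= !mul1r !mul0r f0 => h.
suff : f t - t * f' t <= 0 - 0 by lra.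
apply: h => [c hc e e0|c hc].
  apply: filterS (C1_within_scale_near hf ht hc e0) => s h hs.
  by apply: le_trans (h hs); rewrite le_eqVlt; apply/orP; left; apply/eqP;
     congr (`|_|); ring.
have /andP[t0 tr] := ht; have /andP[c0 c1] := hc.
rewrite -mulrBr mulr_ge0_le0// subr_le0.
by apply: incr_within_le hinc _ _ _ => //; rewrite ?mulr_ge0 ?ler_piMl.
Qed.

(* The derivative f'(a t) - f'(a s) of a |-> f(a t) / t - f(a s) / s is, by
   convexity, maximal at a = 1. *)
Lemma majorant_slope_increment_le (R : realType) (f f' : R -> R) (rad s t : R) :
  C1_within `[0, rad[ f f' ->
  convex_function (`[0, rad[%classic : set R) f' ->
  {in `[0, rad[ &, {homo f' : a b / a < b}} ->
  f 0 = 0 -> 0 < s -> s <= t -> t < rad ->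
  f t / t - f s / s <= f' t - f' s.
Proof.
move=> hf hconv hinc f0 s0 st tr.
have t0 : 0 < t by lra.
have := @derivative_le0_le _
  (fun a => f (a * t) / t - f (a * s) / s - a * (f' t - f' s))
  (fun c => f' (c * t) - f' (c * s) - (f' t - f' s)).
rewrite /= !mul1r !mul0r f0 => h.
suff : f t / t - f s / s - (f' t - f' s) <= 0 / t - 0 / s - 0.
  by rewrite !mul0r; lra.
apply: h => [c hc e e0|c hc]; last first.
  rewrite subr_le0; apply: convex_increment_le hconv hinc _ _ _ _ => //; lra.
have et0 : 0 < e / 2 * t by rewrite mulr_gt0// divr_gt0.
have es0 : 0 < e / 2 * s by rewrite mulr_gt0// divr_gt0.
have ht : 0 <= t < rad by lra.
have hs : 0 <= s < rad by lra.
apply: filterS2 (C1_within_scale_near hf ht hc et0)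
  (C1_within_scale_near hf hs hc es0) => a hat has ha.
move: (hat ha) (has ha) => {}hat {}has.
have -> : f (a * t) / t - f (a * s) / s - a * (f' t - f' s) -
   (f (c * t) / t - f (c * s) / s - c * (f' t - f' s)) -
   (f' (c * t) - f' (c * s) - (f' t - f' s)) * (a - c) =
   (f (a * t) - f (c * t) - t * f' (c * t) * (a - c)) / t -
   (f (a * s) - f (c * s) - s * f' (c * s) * (a - c)) / s.
  by field; rewrite !gt_eqF.
apply: le_trans (ler_normB _ _) _; rewrite !normrM !normfV (gtr0_norm t0) (gtr0_norm s0).
have -> : e * `|a - c| = e / 2 * t * `|a - c| / t + e / 2 * s * `|a - c| / s.
  by field; rewrite !gt_eqF.
by rewrite lerD// ler_wpM2r// invr_ge0 ltW.
Qed.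

(** The ratio minus 1 equals [(f' a - f a / a) / (- f' a)]: the numerator is nonnegative and
    nondecreasing, the denominator positive and nonincreasing. *)
Lemma rate_le (R : realType) (f f' : R -> R) (rad vtheta om1 om2 s t : R) :
  C1_within `[0, rad[ f f' ->
  convex_function (`[0, rad[%classic : set R) f' ->
  {in `[0, rad[ &, {homo f' : a b / a < b}} ->
  f 0 = 0 -> 0 <= om1 -> 0 <= vtheta ->
  0 < s -> s <= t -> t < rad -> f' t < 0 ->
  rate f f' vtheta om1 om2 s <= rate f f' vtheta om1 om2 t.
Proof.
move=> hf hconv hinc f0 om1ge0 vge0 s0 st tr ft0.
have t0 : 0 < t by lra.
have fst : f' s <= f' t by apply: incr_within_le hinc _ _ _ => //; lra.
have fs0 : f' s < 0 by lra.
rewrite /rate !lerD2r ler_wpM2l//; first by rewrite mulr_ge0// addr_ge0.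
have ratioE a : 0 < a -> f' a < 0 ->
    f a / (a * f' a) - 1 = (f' a - f a / a) * (- f' a)^-1.
  move=> a0 fa; have ? := lt0r_neq0 a0; have ? := ltr0_neq0 fa.
  by field; apply/andP.
rewrite !ratioE//.
have hp := majorant_slope_increment_le hf hconv hinc f0 s0 st tr.
have pt0 : 0 <= f' t - f t / t.
  rewrite subr_ge0 ler_pdivrMr// mulrC.
  by apply: majorant_le_tangent hf f0 hinc _; lra.
apply: (@le_trans _ _ ((f' t - f t / t) * (- f' s)^-1)).
  by rewrite ler_wpM2r ?invr_ge0//; lra.
by rewrite ler_wpM2l// lef_pV2 ?posrE//; lra.
Qed.

(** * Invertibility from a trivial kernel, and the balls given by the radii *)

Lemma unitmx_of_ker0 (K : fieldType) (n : nat) (A : 'M[K]_n) :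
  (forall v : 'cV[K]_n, A *m v = 0 -> v = 0) -> A \in unitmx.
Proof.
move=> kerA; rewrite -unitmx_tr -row_free_unit -kermx_eq0.
apply/eqP/row_matrixP => i; rewrite row0; apply: trmx_inj; rewrite trmx0.
apply: kerA; apply: trmx_inj; rewrite trmx_mul trmxK trmx0.
by rewrite -row_mul mulmx_ker row0.
Qed.

Lemma nball_sup (R : realType) (n : nat) (N : 'cV[R]_n -> R) xs (E : set R) x :
  is_norm N -> nball N xs (sup E) x -> exists2 t, E t & N (x - xs) < t.
Proof.
(* If [E] is empty its supremum is 0 by convention, and the ball of radius 0 has no points. *)
move=> hN xE; apply: sup_gt => //; apply/set0P/eqP => E0.
by move: xE; rewrite /nball /= E0 sup0 ltNge is_norm_ge0.
Qed.

Lemma nball_kappa (R : realType) (n : nat) (N : 'cV[R]_n -> R)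
    (Omega : set 'cV[R]_n) xs (rad : R) x :
  is_norm N -> nball N xs (kappa N Omega xs rad) x ->
  Omega x /\ N (x - xs) < rad.
Proof.
move=> hN /(nball_sup hN)[t [/andP[t0 tr] tO] xt].
by split; [exact: tO|exact: lt_trans xt tr].
Qed.

(** The suprema defining [rho] and [nu] provide points beyond [N (x - xs)] where the two conditions
    hold; monotonicity of [f'] and of the rate brings both back to [N (x - xs)]. *)
Lemma nball_rho (R : realType) (n : nat) (N : 'cV[R]_n -> R)
    (f f' : R -> R) (rad vtheta om1 om2 : R) xs x :
  is_norm N ->
  C1_within `[0, rad[ f f' ->
  convex_function (`[0, rad[%classic : set R) f' ->
  {in `[0, rad[ &, {homo f' : a b / a < b}} ->
  f 0 = 0 -> 0 <= om1 -> 0 <= vtheta -> x != xs ->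
  nball N xs (rho f f' rad vtheta om1 om2) x ->
  f' (N (x - xs)) < 0 /\ rate f f' vtheta om1 om2 (N (x - xs)) < 1.
Proof.
move=> hN hf hconv hinc f0 om1ge0 vge0 xxs /(nball_sup hN)[t].
move=> [/andP[t0 tnu] rt1] xt.
have nx0 : 0 < N (x - xs) by rewrite is_norm_gt0// subr_eq0.
have [|s [/andP[s0 sr] fs0] ts] := @sup_gt _ _ t _ tnu.
  apply/set0P/eqP => E0; move: tnu; rewrite /nu E0 sup0; lra.
have ft0 : f' t < 0.
  by apply: le_lt_trans fs0; apply: incr_within_le hinc _ _ _ => //; lra.
split.
  by apply: le_lt_trans ft0; apply: incr_within_le hinc _ _ _ => //; lra.
apply: le_lt_trans rt1.
by apply: rate_le hf hconv hinc _ _ _ _ _ _ _ => //; lra.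
Qed.

(** * One step of the method under the majorant condition *)

Section majorant_condition.
Variables (R : realType) (n : nat) (N : 'cV[R]_n -> R).
Hypothesis hN : is_norm N.
Variables (Omega : set 'cV[R]_n) (F : 'cV[R]_n -> 'cV[R]_n).
Hypothesis hF : C1_on Omega F.
Variables (xs : 'cV[R]_n) (rad : R).
Hypothesis hFxs : F xs = 0.
Hypothesis hF'xs : jac F xs \in unitmx.
Variables f f' : R -> R.
Hypothesis hf : C1_within `[0, rad[ f f'.
Hypothesis hmaj : forall (tau : R) (x : 'cV[R]_n), 0 <= tau <= 1 ->
  nball N xs (kappa N Omega xs rad) x ->
  opnorm N (invmx (jac F xs) *m (jac F x - jac F (xs + tau *: (x - xs))))
    <= f' (N (x - xs)) - f' (tau * N (x - xs)).
Hypotheses (hf0 : f 0 = 0) (hf'0 : f' 0 = -1).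

(** For [tau = 0] the majorant condition bounds the distance of F'(xs)^-1 F'(x) from the identity by
    [f' (N (x - xs)) + 1]; the reverse triangle inequality does the rest. *)
Lemma jac_lower_bound x v : nball N xs (kappa N Omega xs rad) x ->
  - f' (N (x - xs)) * N v <= N (invmx (jac F xs) *m (jac F x *m v)).
Proof.
move=> hx; have := hmaj (tau := 0) _ hx.
rewrite scale0r addr0 mul0r hf'0 lexx ler01 => /(_ erefl).
move=> /(fun h => le_opnorm_bound v hN h).
move: (jac F x) (jac F xs) hF'xs => J J0 J0u.
have -> : invmx J0 *m (J - J0) *m v = invmx J0 *m (J *m v) - v.
  by rewrite -mulmxA mulmxBl mulmxBr (mulKmx J0u).
move: (invmx _ *m _) => w wv.
by have := norm_triangle hN w (v - w); rewrite addrC subrK (is_norm_distC v)//; lra.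
Qed.

Lemma jac_unit x : nball N xs (kappa N Omega xs rad) x ->
  f' (N (x - xs)) < 0 -> jac F x \in unitmx.
Proof.
move=> hx fx0; apply: unitmx_of_ker0 => v Jv0.
have := jac_lower_bound v hx; rewrite Jv0 mulmx0 is_norm0// => h.
apply: (norm_definite hN); apply/eqP; rewrite eq_le is_norm_ge0// andbT.
by move: h; rewrite pmulr_rle0// oppr_gt0.
Qed.

Lemma linearization_error x : nball N xs (kappa N Omega xs rad) x ->
  N (invmx (jac F xs) *m (jac F x *m (x - xs) - F x)) <=
    N (x - xs) * f' (N (x - xs)) - f (N (x - xs)).
Proof.
move=> hx; have [_ xr] := nball_kappa hN hx.
set A := invmx (jac F xs); set v := x - xs; set t := N v.
have t0 : 0 <= t by exact: is_norm_ge0.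
have htr : 0 <= t < rad by rewrite t0.
pose G (s : R) := A *m (s *: (jac F x *m v) - F (xs + s *: v)).
(* This is the derivative of [G]; the majorant condition with [tau = s] bounds its norm by
   [t * (f' t - f' (s * t))]. *)
pose dG (s : R) := A *m (jac F x - jac F (xs + s *: v)) *m v.
have : N (G 1 - G 0) <= (1 * (t * f' t) - f (1 * t)) - (0 * (t * f' t) - f (0 * t)).
  apply: (@mean_value_inequality _ _ _ G dG (fun s => s * (t * f' t) - f (s * t))
     (fun s => t * f' t - t * f' (s * t))) => // c hc.
  - move=> e e0; have /andP[c0 c1] := hc.
    have Oc : Omega (xs + c *: v).
      apply: (fun h => (nball_kappa hN h).1); apply: le_lt_trans hx.
      by rewrite addrAC subrr add0r norm_homogeneous// ger0_norm// ler_piMl.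
    (* The 1 keeps the denominator positive when [t = 0]. *)
    have Ae0 : 0 < e / (opnorm N A * t + 1).
      by rewrite divr_gt0// ltr_wpDl// mulr_ge0// opnorm_ge0.
    have line_cvg : (fun s : R => xs + s *: v) @ c --> xs + c *: v.
      by apply: cvgD; [exact: cvg_cst|exact: scalel_continuous].
    have := line_cvg _ (jac_near hN (hF.1 _ Oc) Ae0).
    apply: (@filterS _ (nbhs c)) => s /= hs _.
    have -> : G s - G c - (s - c) *: dG c = - (A *m
        (F (xs + s *: v) - F (xs + c *: v) - jac F (xs + c *: v) *m
           (xs + s *: v - (xs + c *: v)))).
      have -> : xs + s *: v - (xs + c *: v) = (s - c) *: v.
        by rewrite opprD addrACA subrr add0r scalerBl.
      rewrite /G /dG; move: (jac F x) (jac F (xs + c *: v)) => J Jc.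
      move: (F (xs + s *: v)) (F (xs + c *: v)) => Fs Fc.
      rewrite -mulmxBr -[A *m _ *m v]mulmxA (scalemxAr _ A) -mulmxBr -mulmxN.
      congr (_ *m _); rewrite mulmxBl -scalemxAr scalerBr !scalerBl.
      apply/colP => i; rewrite !mxE; ring.
    rewrite is_normN//; apply: le_trans (opnorm_bound _ _ hN) _.
    apply: le_trans (ler_wpM2l (opnorm_ge0 _ hN) hs) _.
    rewrite opprD addrACA subrr add0r -scalerBl norm_homogeneous// -/t.
    rewrite [leLHS](_ : _ = e * `|s - c| * (opnorm N A * t) / (opnorm N A * t + 1)).
      rewrite ler_pdivrMr; last by rewrite ltr_wpDl// mulr_ge0// opnorm_ge0.
      by rewrite ler_wpM2l ?mulr_ge0 ?(ltW e0)// lerDl.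
    by field; rewrite gt_eqF// ltr_wpDl// mulr_ge0// opnorm_ge0.
  - move=> e e0; apply: filterS (C1_within_scale_near hf htr hc e0) => s h hs.
    apply: le_trans (h hs); rewrite -normrN le_eqVlt; apply/orP; left.
    by apply/eqP; congr (`|_|); ring.
  - rewrite -mulrBr mulrC; exact: le_opnorm_bound (hmaj hc hx).
rewrite !mul1r !mul0r hf0 !subr0 /G !scale0r !scale1r addr0 hFxs subrr mulmx0 subr0.
by rewrite [xs + v]addrC subrK.
Qed.

(** Apply the lower bound to the vector F'(x)^-1 w, with [w] the linearization error, and divide by
    [- f' (N (x - xs)) > 0]. *)
Lemma inverse_linearization_error x : nball N xs (kappa N Omega xs rad) x ->
  x != xs -> f' (N (x - xs)) < 0 ->
  N (invmx (jac F x) *m (jac F x *m (x - xs) - F x)) <=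
    (f (N (x - xs)) / (N (x - xs) * f' (N (x - xs))) - 1) * N (x - xs).
Proof.
move=> hx xxs fx0; have nx0 : 0 < N (x - xs) by rewrite is_norm_gt0// subr_eq0.
have := linearization_error hx; set w := jac F x *m _ - _ => hw.
have := jac_lower_bound (invmx (jac F x) *m w) hx; rewrite mulKVmx ?jac_unit// => h.
have {hw} := le_trans h hw; rewrite mulrC -ler_pdivlMr ?oppr_gt0// => /le_trans; apply.
rewrite le_eqVlt; apply/orP; left; apply/eqP.
by field; rewrite (lt0r_neq0 nx0) (ltr0_neq0 fx0).
Qed.

Variables (B : 'cV[R]_n -> 'M[R]_n) (vtheta om1 om2 : R).
Hypotheses (om1ge0 : 0 <= om1) (vge0 : 0 <= vtheta).

Lemma step_error_le P theta S r x x1 :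
  inexact_newton_like_step N F B vtheta om1 om2 P theta S r x x1 ->
  nball N xs (kappa N Omega xs rad) x -> x != xs -> f' (N (x - xs)) < 0 ->
  N (x1 - xs) <= rate f f' vtheta om1 om2 (N (x - xs)) * N (x - xs).
Proof.
move=> [-> hS hB h1 h2 hP th0 hr hc] hx xxs fx0.
have hJ := jac_unit hx fx0; have herr := inverse_linearization_error hx xxs fx0.
rewrite /rate; set t := N (x - xs) in herr fx0 *; set g := _ - 1 in herr *.
set A := jac F x in h1 h2 hc hJ herr *; set w := A *m _ - _ in herr.
have t0 : 0 <= t by exact: is_norm_ge0.
have AF : invmx A *m F x = (x - xs) - invmx A *m w.
  by rewrite /w mulmxBr mulKmx// opprB addrC subrK.
have nAF : N (invmx A *m F x) <= (1 + g) * t.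
  have := norm_triangle hN (x - xs) (- (invmx A *m w)).
  by rewrite is_normN// -AF -/t; lra.
have hPA : P *m A \in unitmx by rewrite unitmx_mul hP hJ.
(* Writing A^-1 r = (P A)^-1 (P r) and P F = (P A) (A^-1 F) makes the condition number of [P *m A]
   appear. *)
have nAr : N (invmx A *m r) <= vtheta * ((1 + g) * t).
  have -> : invmx A *m r = invmx (P *m A) *m (P *m r).
    by rewrite -{1}(mulKmx hPA (invmx A *m r)) -mulmxA mulKVmx.
  apply: le_trans (opnorm_bound _ _ hN) _.
  have PF : N (P *m F x) <= opnorm N (P *m A) * N (invmx A *m F x).
    have -> : P *m F x = P *m A *m (invmx A *m F x).
      by rewrite -mulmxA mulKVmx.
    exact: opnorm_bound.
  apply: le_trans (ler_wpM2l (opnorm_ge0 _ hN) hr) _.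
  apply: le_trans (ler_wpM2l (opnorm_ge0 _ hN) (ler_wpM2l th0 PF)) _.
  rewrite (_ : _ * (_ * (_ * _)) = theta * condn N (P *m A) * N (invmx A *m F x)); last first.
    by rewrite /condn; ring.
  apply: le_trans (ler_wpM2r (is_norm_ge0 _ hN) hc) _.
  by rewrite ler_wpM2l.
have -> : x + S - xs = - ((invmx (B x) *m A - 1%:M) *m (x - xs))
    + invmx (B x) *m A *m (invmx A *m w) + invmx (B x) *m A *m (invmx A *m r).
  have -> : S = invmx (B x) *m (- F x + r) by rewrite -hS mulKmx.
  rewrite addrAC mulmxBl mul1mx -!mulmxA !mulKVmx// /w.
  move: (x - xs) => v; rewrite mulmxBr mulmxDr mulmxN.
  by apply/colP => i; rewrite !mxE; ring.
apply: le_trans (norm_triangle hN _ _) _.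
apply: le_trans (lerD (norm_triangle hN _ _) (lexx _)) _.
rewrite is_normN//.
(* The three terms contribute [om2 * t], [om1 * g * t] and [om1 * vtheta * (1 + g) * t], which add
   up to the rate times [t]. *)
have b1 := le_opnorm_bound (x - xs) hN h2; rewrite -/t in b1.
have b2 := le_trans (le_opnorm_bound (invmx A *m w) hN h1) (ler_wpM2l om1ge0 herr).
have b3 := le_trans (le_opnorm_bound (invmx A *m r) hN h1) (ler_wpM2l om1ge0 nAr).
apply: le_trans (lerD (lerD b1 b2) b3) _.
by rewrite le_eqVlt; apply/orP; left; apply/eqP; ring.
Qed.

(** Covers an iterate equal to [xs], where the quotient in the rate degenerates: F(xs) = 0 forces
    the residual and then the step to vanish. *)
Lemma step_at_zero P theta S r x1 :
  inexact_newton_like_step N F B vtheta om1 om2 P theta S r xs x1 -> x1 = xs.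
Proof.
move=> [-> hS hB _ _ hP _ + _]; rewrite hFxs mulmx0 is_norm0// mulr0 => hr.
have /(norm_definite hN) Pr0 : N (P *m r) = 0.
  by apply/eqP; rewrite eq_le hr is_norm_ge0.
have r0 : r = 0 by rewrite -(mulKmx hP r) Pr0 mulmx0.
by rewrite -(mulKmx hB S) hS hFxs r0 oppr0 addr0 mulmx0 addr0.
Qed.

End majorant_condition.

(** * Induction along the iterates and geometric convergence *)

Theorem theorem4 (R : realType) (n : nat) (N : 'cV[R]_n -> R)
  (hN : is_norm N)
  (Omega : set 'cV[R]_n) (hOmega : open Omega)
  (F : 'cV[R]_n -> 'cV[R]_n) (hF : C1_on Omega F)
  (xs : 'cV[R]_n) (hxs : Omega xs)
  (rad : R) (hrad : 0 < rad)
  (hFxs : F xs = 0) (hF'xs : jac F xs \in unitmx)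
  (f f' : R -> R) (hf : C1_within `[0, rad[ f f')
  (hmaj : forall (tau : R) (x : 'cV[R]_n), 0 <= tau <= 1 ->
     nball N xs (kappa N Omega xs rad) x ->
     opnorm N (invmx (jac F xs) *m (jac F x - jac F (xs + tau *: (x - xs))))
       <= f' (N (x - xs)) - f' (tau * N (x - xs)))
  (hf0 : f 0 = 0) (hf'0 : f' 0 = -1)
  (hconv : convex_function (`[0, rad[%classic : set R) f')
  (hincr : {in `[0, rad[ &, {homo f' : s t / s < t}})
  (vtheta om1 om2 : R)
  (hvtheta : 0 <= vtheta < 1) (hom : 0 <= om2 < om1)
  (hom_lt1 : om1 * vtheta + om2 < 1)
  (B : 'cV[R]_n -> 'M[R]_n)
  (P : nat -> 'M[R]_n) (theta : nat -> R)
  (x S r : nat -> 'cV[R]_n)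
  (hx0 : nball N xs (sigma N Omega xs f f' rad vtheta om1 om2) (x 0%N))
  (hx0xs : x 0%N != xs) :
  let step := fun k : nat =>
    inexact_newton_like_step N F B vtheta om1 om2
      (P k) (theta k) (S k) (r k) (x k) (x k.+1) in
  (forall m : nat, (forall k : nat, (k < m)%N -> step k) ->
     Omega (x m) /\ jac F (x m) \in unitmx)
  /\
  ((forall k : nat, step k) ->
     [/\ forall k : nat,
           nball N xs (sigma N Omega xs f f' rad vtheta om1 om2) (x k),
         x k @[k --> \oo] --> xs
       & forall k : nat,
           N (x k.+1 - xs) <=
             rate f f' vtheta om1 om2 (N (x 0%N - xs)) * N (x k - xs)]).
Proof.
move=> step.
have [/andP[v0 v1] /andP[om2ge0 om21]] := (hvtheta, hom).
have om1ge0 : 0 <= om1 by lra.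
set t0 := N (x 0%N - xs); set q := rate f f' vtheta om1 om2 t0.
move: (hx0); rewrite /nball /sigma /= lt_min => /andP[x0kappa x0rho].
have [ft0 q1] := nball_rho hN hf hconv hincr hf0 om1ge0 v0 hx0xs x0rho.
have [_ t0rad] := nball_kappa hN x0kappa.
have in_kappa y : N (y - xs) <= t0 -> nball N xs (kappa N Omega xs rad) y.
  by move=> yt0; exact: le_lt_trans yt0 x0kappa.
have fy0 y : N (y - xs) <= t0 -> f' (N (y - xs)) < 0.
  move=> yt0; apply: le_lt_trans ft0.
  by apply: incr_within_le hincr _ _ _ => //; exact: is_norm_ge0.
have contraction k : N (x k - xs) <= t0 -> step k ->
    N (x k.+1 - xs) <= q * N (x k - xs).
  move=> xkt0 stk; have [xkxs|xkxs] := eqVneq (x k) xs.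
    move: stk; rewrite /step xkxs => /(step_at_zero hN hFxs) ->.
    by rewrite subrr is_norm0// mulr0.
  apply: le_trans (step_error_le hN hF hFxs hF'xs hf hmaj hf0 hf'0 om1ge0 v0
    stk (in_kappa _ xkt0) xkxs (fy0 _ xkt0)) _.
  rewrite ler_wpM2r ?is_norm_ge0//.
  apply: rate_le hf hconv hincr _ _ _ _ _ _ _ => //.
  by rewrite is_norm_gt0// subr_eq0.
(* Only the steps before [m] are assumed, so the bound also serves well-definedness of a run not yet
   completed. *)
have bounded m : (forall k, (k < m)%N -> step k) -> N (x m - xs) <= t0.
  elim: m => [//|m IHm] st.
  have xmt0 : N (x m - xs) <= t0 by apply: IHm => k km; apply: st; exact: ltnW.
  apply: le_trans (contraction m xmt0 (st m (ltnSn m))) (le_trans _ xmt0).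
  by rewrite ler_piMl ?is_norm_ge0// ltW.
split=> [m st|st].
  have xmt0 := bounded m st; split.
    by have [] := nball_kappa hN (in_kappa _ xmt0).
  by apply: (jac_unit hN hF'xs hmaj hf'0) => //; [exact: in_kappa|exact: fy0].
have bnd k : N (x k - xs) <= t0 by apply: bounded.
have t00 : 0 < t0 by rewrite is_norm_gt0// subr_eq0.
(* The sign is read off the first step: [0 <= N (x 1 - xs) <= q * t0] with [t0 > 0]. *)
have q0 : 0 <= q.
  have := le_trans (is_norm_ge0 _ hN) (contraction 0%N (bnd 0%N) (st 0%N)).
  by rewrite pmulr_lge0.
have geo k : N (x k - xs) <= q ^+ k * t0.
  elim: k => [|k IHk]; first by rewrite mul1r.
  apply: le_trans (contraction k (bnd k) (st k)) _.
  by rewrite exprS -mulrA ler_wpM2l.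
split=> [k||k]; [exact: le_lt_trans (bnd k) hx0| |exact: contraction].
(* Convergence refers to the sup norm, so the geometric bound in [N] is transferred with the
   constant [D]. *)
have [D D0 ND] := mx_norm_le_is_norm hN.
have q_lt1 : `|q| < 1 by rewrite ger0_norm.
have /cvgrPdist_lt geo_cvg := cvg_geometric (D * t0) q_lt1.
apply/cvgrPdist_lt => e e0; apply: filterS (geo_cvg e e0) => k /=.
rewrite sub0r normrN; apply: le_lt_trans; rewrite distrC.
apply: le_trans (ND _) _; apply: le_trans (ler_wpM2l (ltW D0) (geo k)) _.
by rewrite /geometric /= (le_trans _ (ler_norm _))// mulrA mulrAC.
Qed.
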